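(* Let $k$ and $n$ be coprime positive integers, and let $\alpha$ be a primitive element of $\mathbb{F}_{2^n}$. Suppose there exists a $q$-Steiner system $\mathcal{S}_2[2,k,n]$ admitting the Singer subgroup $C_\alpha$ as a group of automorphisms. Then there exists a $(2^n-1,\,2^k-1,\,1)$ difference family over the group $\mathbb{Z}_{2^n-1}$.
   Context: Identify $\mathbb{F}_2^n$ with $\mathbb{F}_{2^n}$ as an $\mathbb{F}_2$-vector space; the Singer subgroup $C_\alpha\le\mathrm{GL}(n,2)$ is the cyclic group of maps $\beta\mapsto\alpha^i\beta$, $0\le i\le 2^n-2$. A $q$-Steiner system $\mathcal{S}_2[2,k,n]$ is a set $\mathcal{S}$ of $k$-dimensional subspaces of $\mathbb{F}_2^n$ such that every $2$-dimensional subspace is contained in exactly one member of $\mathcal{S}$. A group $A\le\mathrm{GL}(n,2)$ is a group of automorphisms of $\mathcal{S}$ if $\{gX: X\in\mathcal{S}\}=\mathcal{S}$ for all $g\in A$. A $(v,k',\lambda)$ difference family over an additive group $G$ of order $v$ is a collection $B_1,\ldots,B_s$ of $k'$-subsets of $G$ such that every nonidentity element of $G$ occurs exactly $\lambda$ times in the multiset $\{a-b : a,b\in B_i,\ a\ne b,\ 1\le i\le s\}$. *)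

(* Defs.v *)
(* Mathematical Components *)
From mathcomp Require Import all_boot all_order all_algebra all_field.

Set Implicit Arguments.
Unset Strict Implicit.
Unset Printing Implicit Defensive.

Import GRing.Theory.
Local Open Scope ring_scope.

(* Subgroups of GL(V), as sets of endomorphisms of V.  On an injective
   endomorphism, g^-1 is the two-sided inverse. *)
Definition GL_subgroup (F : fieldType) (V : vectType F) (A : {pred 'End(V)}) :=
  [/\ \1%VF \in A,
      {in A &, forall f g, (f \o g)%VF \in A}
    & {in A, forall g, lker g == 0%VS /\ (g^-1)%VF \in A}].

(* A set of subspaces of V is a boolean predicate on {vspace V}. *)
Definition q_steiner_system (V : vectType 'F_2) (k n : nat)
    (S : {pred {vspace V}}) : Prop :=
  [/\ \dim {:V} = n,
      {in S, forall X, \dim X = k}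
    & forall U : {vspace V}, \dim U = 2%N ->
        exists! X : {vspace V}, X \in S /\ (U <= X)%VS].

Definition automorphism_group (V : vectType 'F_2) (S : {pred {vspace V}})
    (A : {pred 'End(V)}) : Prop :=
  GL_subgroup A /\
  {in A, forall g : 'End(V), forall Y : {vspace V},
    (exists2 X, X \in S & (g @: X)%VS = Y) <-> Y \in S}.

(* The maps b |-> a ^+ i * b for 0 <= i <= 2 ^ n - 2. *)
Definition singer (n : nat) (L : fieldExtType 'F_2) (a : L) : {pred 'End(L)} :=
  [pred g : 'End(L) | [exists i : 'I_(2 ^ n - 1), g == amull (a ^+ i)]].

Lemma singer_GL_subgroup (n : nat) (L : fieldExtType 'F_2) (a : L) :
  (2 ^ n - 1).-primitive_root a -> GL_subgroup (singer n a).
Proof.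
move=> pa; have N0 := prim_order_gt0 pa.
have amullE u x : amull u x = u * x :> L by rewrite lfunE.
have mem m : amull (a ^+ m) \in singer n a.
  apply/existsP; exists (Ordinal (ltn_pmod m N0)).
  by rewrite /= (prim_expr_mod pa).
have ua m : a ^+ m \is a GRing.unit.
  by rewrite unitrX // -(unitrX_pos a N0) prim_expr_order // unitr1.
split.
- by rewrite -(amull1 L) -(expr0 a) mem.
- move=> _ _ /existsP[i /eqP->] /existsP[j /eqP->].
  rewrite (_ : (_ \o _)%VF = amull (a ^+ (i + j))) ?mem //.
  by apply/lfunP=> x; rewrite comp_lfunE !amullE exprD mulrA.
move=> _ /existsP[i /eqP->].
have k0 := lker0_amull (ua i); split=> //.
suff -> : ((amull (a ^+ i))^-1)%VF = amull (a ^+ (2 ^ n - 1 - i)) by [].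
apply/lfunP=> x; apply: (lker0P k0).
rewrite lker0_lfunVK // !amullE mulrA -exprD subnKC; last exact: ltnW.
by rewrite (prim_expr_order pa) mul1r.
Qed.

(* Blocks may be repeated, and the family may be empty. *)
Definition difference_family (G : finZmodType) (v k lambda : nat)
    (B : seq {set G}) : Prop :=
  [/\ #|G| = v,
      {in B, forall b : {set G}, #|b| = k}
    & forall g : G, g != 0 ->
        (\sum_(b <- B)
           #|[set p in setX b b | (p.1 != p.2) && ((p.1 - p.2)%R == g)]| = lambda)%N].

(* Main.v *)
(* Taking discrete logarithms to base alpha identifies the nonzero vectors with
   Z_(2^n-1), and multiplication by alpha with a translation.  A subspace of
   dimension k fixed by multiplication by x is a vector space over the field
   F_2(x), whose degree divides both k and n; hence x lies in F_2, and the
   Singer group acts freely on the system.  A pair of points at difference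
   g <> 0 in a translate of a block corresponds to a translate containing 0
   and g, and exactly one block of the system contains the plane spanned by 1
   and alpha^g.  So one block per orbit gives a difference family. *)
Require Import Defs.
From mathcomp Require Import all_boot all_order all_algebra all_field.
Import GRing.Theory.
Local Open Scope ring_scope.

Definition translate {G : finZmodType} (t : G) (b : {set G}) : {set G} :=
  [set x | x - t \in b].

Section Translate.
Variable G : finZmodType.
Implicit Types (t : G) (b : {set G}).

Lemma translate0 b : translate 0 b = b.
Proof. by apply/setP=> x; rewrite inE subr0. Qed.

Lemma translateD s t b : translate s (translate t b) = translate (s + t) b.
Proof. by apply/setP=> x; rewrite !inE opprD addrA. Qed.

(* [pick] depends only on the extension of its predicate, so this is constant on
   orbits. *)
Definition orbit_repr b : {set G} :=
  odflt b [pick c | [exists t, c == translate t b]].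

Lemma orbit_repr_translate b : exists t, orbit_repr b = translate t b.
Proof.
rewrite /orbit_repr; case: pickP => [c /existsP[t /eqP ->]|_]; first by exists t.
by exists 0; rewrite translate0.
Qed.

Lemma orbit_repr_invariant t b : orbit_repr (translate t b) = orbit_repr b.
Proof.
rewrite /orbit_repr.
rewrite (@eq_pick _ _ (fun c => [exists s, c == translate s b])).
  case: pickP => //= /(_ b)/existsP[]; by exists 0; rewrite translate0.
move=> c; apply/existsP/existsP=> -[s /eqP->].
  by exists (s + t); rewrite translateD.
by exists (s - t); rewrite translateD subrK.
Qed.

(** A pair [(x, y)] of a block with [x - y = g] becomes the pair [(g, 0)] after translation by
    [- y]. So such pairs in the representatives are governed by the one member of [D] through [0]
    and [g]: its orbit is the only one to contribute, and freeness leaves a single [y]. *)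
Lemma orbit_representatives_difference_family (k : nat) (D : {set {set G}}) :
    {in D, forall b : {set G}, #|b| = k} ->
    (forall t, {in D, forall b, translate t b \in D}) ->
    (forall t, {in D, forall b, translate t b = b -> t = 0}) ->
    (forall g, g != 0 -> exists! b : {set G}, [/\ b \in D, 0 \in b & g \in b]) ->
  exists B : seq {set G}, difference_family #|G| k 1 B.
Proof.
move=> Dk Dt Dfree D1; exists (enum [set b in D | orbit_repr b == b]).
split=> // [b|g g0]; first by rewrite mem_enum inE => /andP[/Dk].
have [c [[Dc c0 cg] c_uniq]] := D1 g g0.
have [t rct] := orbit_repr_translate c.
have RcD : orbit_repr c \in D by rewrite rct Dt.
(* Translating [b] by [- s] gives a member of [D] through [0] and [g], hence [c]. As [b] is its own
   representative it is that of [c], and then [- s + t] fixes [c]. *)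
have only s b : b \in D -> orbit_repr b == b -> s \in b -> g + s \in b ->
    b = orbit_repr c /\ s = t.
  move=> Db /eqP rb bs bgs.
  have cE : c = translate (- s) b.
    by apply: c_uniq; rewrite Dt // !inE opprK add0r.
  have bE : b = orbit_repr c by rewrite cE orbit_repr_invariant rb.
  split=> //; have /esym cst : c = translate (- s + t) c.
    by rewrite -translateD -rct -bE.
  by rewrite -[s]addr0 -(Dfree _ c Dc cst) addNKr.
rewrite big_enum_cond /= (bigD1 (orbit_repr c)) /=; last first.
  by rewrite inE RcD rct orbit_repr_invariant -rct eqxx.
rewrite big1 ?addn0 => [|b /andP[]]; last first.
  rewrite inE => /andP[/andP[Db rb] _] /eqP bc; apply/eqP; rewrite cards_eq0.
  apply/eqP/setP=> -[x y]; rewrite !inE /=; apply/negP.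
  case/andP=> /andP[bx by_] /andP[_ /eqP xy].
  by case: (only y b Db rb by_); rewrite -?xy ?subrK.
(* The only surviving pair is [(g, 0)] carried along from [c] to its representative. *)
rewrite -(cards1 (g + t, t)); apply: eq_card => -[x y]; rewrite !inE /=.
apply/idP/eqP => [/andP[/andP[bx by_] /andP[_ /eqP xy]]|[-> ->]].
  have rr : orbit_repr (orbit_repr c) == orbit_repr c.
    by rewrite rct orbit_repr_invariant -rct.
  by case: (only y _ RcD rr by_); rewrite -?xy ?subrK // => _ <-; rewrite subrK.
by rewrite rct !inE addrK subrr cg c0 eqxx -subr_eq0 addrK g0.
Qed.

End Translate.

Lemma stable_coprime_in1 {F : fieldType} {L : fieldExtType F} {X : {vspace L}}
    {x : L} : coprime (\dim X) (\dim {:L}) ->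
  {in X, forall y, x * y \in X} -> x \in 1%VS.
Proof.
move=> cop Xx.
(* Elements of the field generated by [x] are polynomials in [x]; Horner induction shows that each
   maps [X] into itself. *)
have KX : (<<1; x>>%AS * X <= X)%VS.
  apply/prodvP=> _ y /Fadjoin_polyP[_ /polyOver1P[p ->] ->].
  elim/poly_ind: p y => [|p c IHp] y Xy; first by rewrite rmorph0 horner0 mul0r mem0v.
  rewrite rmorphD rmorphM /= map_polyX map_polyC hornerMXaddC mulrDl -mulrA.
  by rewrite memvD ?IHp ?Xx // mulr_algl memvZ.
have := field_module_dimS KX.
have := @field_module_dimS _ _ <<1; x>>%AS {:L}%VS (subvf _).
move=> dn dk; have d1 : \dim <<1; x>> = 1%N.
  by apply/eqP; rewrite -dvdn1 -(eqP cop) dvdn_gcd dk.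
have -> : 1%VS = <<1; x>>%VS.
  by apply/eqP; rewrite eqEdim sub1v dimv1 d1.
exact: memv_adjoin.
Qed.

Lemma F2_line_eq {V : vectType 'F_2} {x y : V} :
  x != 0 -> x \in <[y]>%VS -> x = y.
Proof.
move=> x0 /vlineP[c xE]; rewrite xE.
have : c != 0 by apply: contra_neq x0 => c0; rewrite xE c0 scale0r.
case: c {xE} => -[|[|m]] //= lt2 _.
by rewrite -[RHS]scale1r; congr (_ *: _); apply: val_inj.
Qed.

(** A line over the two-element field has only one nonzero vector, so distinct nonzero vectors are
    independent. *)
Lemma F2_dim_span2 {V : vectType 'F_2} {x y : V} :
  x != 0 -> y != 0 -> x != y -> \dim <<[:: x; y]>> = 2%N.
Proof.
move=> x0 y0 xy; apply/eqP; rewrite -[_ == _]/(free [:: x; y]) free_cons seq1_free y0.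
by rewrite span_seq1 andbT; apply: contra_neqN xy => /F2_line_eq->.
Qed.

Section DiscreteLog.
Set Implicit Arguments.
Unset Strict Implicit.
Variables (L : fieldExtType 'F_2) (N : nat) (alpha : L).
Hypotheses (dimN : N.+1 = (2 ^ \dim {:L} - 1)%N)
  (prim_alpha : N.+1.-primitive_root alpha).
Implicit Types (i j : 'I_N.+1) (X : {vspace L}).

Definition dpow i : L := alpha ^+ i.

Lemma dpow0 : dpow 0 = 1. Proof. by []. Qed.

Lemma dpowD i j : dpow (i + j) = dpow i * dpow j.
Proof. by rewrite /dpow -exprD (prim_expr_mod prim_alpha). Qed.

Lemma dpow_neq0 i : dpow i != 0.
Proof.
apply/eqP=> i0; have := dpowD (- i) i; rewrite addNr dpow0 i0 mulr0 => /eqP.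
by rewrite oner_eq0.
Qed.

Lemma dpow_inj : injective dpow.
Proof.
move=> i j /eqP; rewrite (eq_prim_root_expr prim_alpha) !modn_small // => /eqP.
exact: val_inj.
Qed.

Lemma dpow_surj (x : L) : x != 0 -> exists i, x = dpow i.
Proof.
move=> x0; suff /(prim_rootP prim_alpha)[i ->] : x ^+ N.+1 = 1 by exists i.
(* After multiplication by [x] the goal is [x ^+ q = x], with [q] the number of elements of [L]. *)
apply: (mulfI x0); rewrite mulr1 -exprS dimN subn1 prednK ?expn_gt0 //.
have <- : #|finvect_type L| = (2 ^ \dim {:L})%N.
  have := @card_vspace _ (finvect_type L) _ {:L}; rewrite card_Fp // => <-.
  by apply: eq_card => y; rewrite memvf.
exact: (@expf_card (FinFieldExtType L) x).
Qed.

Definition dlog_set X : {set 'I_N.+1} := [set i | dpow i \in X].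

Lemma dlog_setK X :
  <<[seq dpow i | i <- enum (dlog_set X)]>>%VS = X.
Proof.
apply/esym/eqP; rewrite eqEsubv; apply/andP; split.
  apply/subvP=> x Xx; have [->|/dpow_surj[i xi]] := eqVneq x 0; first exact: mem0v.
  by rewrite memv_span // xi map_f // mem_enum inE -xi.
apply/span_subvP=> _ /mapP[i + ->].
by rewrite mem_enum inE.
Qed.

Lemma card_dlog_set X : #|dlog_set X| = (2 ^ \dim X - 1)%N.
Proof.
have <- : #|[pred x : finvect_type L | x \in X]| = (2 ^ \dim X)%N.
  by rewrite card_vspace card_Fp.
(* The zero vector has no logarithm; removing it accounts for the subtracted 1. *)
have X0 : (0 : finvect_type L) \in [pred x : finvect_type L | x \in X] by apply: mem0v.
rewrite (cardD1 (0 : finvect_type L)) X0 add1n subn1 /=.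
rewrite -(@card_imset _ (finvect_type L) _ (mem (dlog_set X)) dpow_inj).
apply: eq_card => x; rewrite !inE; apply/imsetP/andP => [[i]|[x0 Xx]].
  by rewrite inE => Xi ->; rewrite dpow_neq0.
by have [i xi] := dpow_surj x0; exists i; rewrite // inE -xi.
Qed.

Lemma dlog_set_amull i X :
  dlog_set (amull (dpow i) @: X) = translate i (dlog_set X).
Proof.
have mulE j : amull (dpow i) (dpow j) = dpow (i + j).
  by rewrite lfunE /= dpowD.
apply/setP=> j; rewrite !inE; apply/idP/idP => [/memv_imgP[x Xx]|Xj].
  rewrite lfunE /= => ij; suff -> : dpow (j - i) = x by [].
  by apply: (mulfI (dpow_neq0 i)); rewrite -ij -dpowD addrC subrK.
by apply/memv_imgP; exists (dpow (j - i)) => //; rewrite mulE addrC subrK.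
Qed.

Lemma dlog_set_stable k i X : \dim X = k -> coprime k (\dim {:L}) ->
  translate i (dlog_set X) = dlog_set X -> i = 0.
Proof.
move=> <- cop stab.
have : dpow i \in 1%VS.
  apply: (stable_coprime_in1 cop) => y Xy.
  have [->|/dpow_surj[j yj]] := eqVneq y 0; first by rewrite mulr0 mem0v.
  have : i + j \in dlog_set X by rewrite -stab inE addrAC subrr add0r inE -yj.
  by rewrite inE dpowD -yj.
(* The only nonzero element of the prime field is [1], whose logarithm is [0]. *)
by move/(F2_line_eq (dpow_neq0 i)); rewrite -dpow0 => /dpow_inj.
Qed.

End DiscreteLog.

(* 'I_(2 ^ n - 1).-1.+1 is the additive group of integers modulo 2 ^ n - 1,
   including the trivial group for n = 1 (where 'Z_1 would be wrong). *)
Theorem theorem7 (k n : nat) (k_gt0 : (0 < k)%N) (n_gt0 : (0 < n)%N)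
    (k_n_coprime : coprime k n)
    (L : fieldExtType 'F_2) (dimL : \dim {:L} = n)
    (alpha : L) (alpha_primitive : (2 ^ n - 1).-primitive_root alpha)
    (steiner : exists S : {pred {vspace L}},
       q_steiner_system k n S /\ automorphism_group S (singer n alpha)) :
  exists B : seq {set 'I_(2 ^ n - 1).-1.+1},
    difference_family (2 ^ n - 1) (2 ^ k - 1) 1 B.
Proof.
have [S [[_ dimS SU] [_ SA]]] := steiner.
have dimN : (2 ^ n - 1).-1.+1 = (2 ^ n - 1)%N.
  by rewrite prednK // (prim_order_gt0 alpha_primitive).
have {}SA (i : 'I_(2 ^ n - 1)) X : X \in S -> (amull (alpha ^+ i) @: X)%VS \in S.
  move=> SX; apply/(SA (amull (alpha ^+ i))); last by exists X.
  by apply/existsP; exists i.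
move: SA alpha_primitive; rewrite -dimN; move: (_.-1) dimN => N dimN SA pa.
rewrite -dimL in dimN k_n_coprime.
pose dl : {vspace L} -> _ := @dlog_set L N alpha.
pose sp (b : {set 'I_N.+1}) := <<[seq dpow alpha i | i <- enum b]>>%VS.
have spK X : sp (dl X) = X by exact: dlog_setK dimN pa X.
(* The image of [S] under [dl], made a finite set by testing membership through the left inverse
   [sp]. *)
pose D := [set b : {set 'I_N.+1} | (sp b \in S) && (b == dl (sp b))].
have memD X : (dl X \in D) = (X \in S) by rewrite inE spK eqxx andbT.
have DP b : b \in D -> exists2 X, X \in S & b = dl X.
  by rewrite inE => /andP[Sb /eqP bE]; exists (sp b).
have := @orbit_representatives_difference_family _ (2 ^ k - 1) D.
rewrite card_ord; apply=> [b /DP[X SX ->]|i b /DP[X SX ->]|i b /DP[X SX ->]|g g0].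
- by rewrite (card_dlog_set dimN pa) (dimS _ SX).
- by rewrite -(dlog_set_amull pa) memD SA.
- exact: (dlog_set_stable dimN pa (dimS _ SX)).
(* Since [g] is nonzero, [dpow alpha g] differs from [1] and the two span a plane. A subspace
   contains this plane exactly when its logarithm set contains [0] and [g]. *)
have /SU[X [[SX UX] X_uniq]] : \dim <<[:: 1; dpow alpha g]>> = 2%N.
  rewrite (F2_dim_span2 (oner_neq0 _) (dpow_neq0 pa g)) //.
  by rewrite eq_sym -(dpow0 N alpha) (inj_eq (dpow_inj pa)).
have inU Y : (<<[:: 1%R; dpow alpha g]>> <= Y)%VS = (0 \in dl Y) && (g \in dl Y).
  by rewrite span_cons span_seq1 subv_add -!memvE !inE dpow0.
exists (dl X); split=> [|_ [/DP[Y SY ->] Y0 Yg]].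
  by move: UX; rewrite inU memD => /andP[].
by rewrite (X_uniq Y) // inU Y0.
Qed.
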